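(* Let $\mathcal{S}$ be a finite set of states with nominal parameters $(p_s^0,r_s^0)$ and uncertainty sets $\mathcal{U}_s \ni (p_s^0,r_s^0)$, $s\in\mathcal{S}$, and let $(p,r)=(p_s,r_s)_{s\in\mathcal{S}}$ be random parameters taking values in $\mathcal{U}=\prod_{s\in\mathcal{S}}\mathcal{U}_s$. Suppose the parameters of different states deviate independently, with probability $\alpha_s$ for $s\in\mathcal{S}$; that is, the events $\{(p_s,r_s)\neq(p_s^0,r_s^0)\}$, $s\in\mathcal{S}$, are mutually independent and the event for $s$ has probability $\alpha_s$. Let $\delta\in(0,1)$ and $$D' = \sum_{s\in\mathcal{S}}\alpha_s+\frac13\log(1/\delta)\left(1+\sqrt{1+18\,\frac{\sum_{s\in\mathcal{S}}\alpha_s}{\log(1/\delta)}}\right).$$ Then with probability at least $1-\delta$ we have $(p,r)\in\mathcal{U}_{D'}$.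
   Context: $\mathcal{S}$ is the finite state space and $\mathcal{A}$ the finite action space of a Markov decision process. For a state $s$, $p_s=(p(\cdot\mid s,a))_{a\in\mathcal{A}}$ denotes the transition probabilities out of $s$ and $r_s=(r(s,a))_{a\in\mathcal{A}}$ the rewards in $s$. For each $s$ there are known nominal parameters $(p_s^0,r_s^0)$ and a convex uncertainty set $\mathcal{U}_s$ of possible values of $(p_s,r_s)$ with $(p_s^0,r_s^0)\in\mathcal{U}_s$. The parameters of state $s$ are said to deviate if $(p_s,r_s)\neq(p_s^0,r_s^0)$. For a real number $D\ge 0$, $$\mathcal{U}_D=\Big\{(p,r)\in\mathcal{U}\ \Big|\ \sum_{s\in\mathcal{S}}\mathbf{1}_{(p_s,r_s)\neq(p_s^0,r_s^0)}\le D\Big\},\qquad \mathcal{U}=\prod_{s\in\mathcal{S}}\mathcal{U}_s .$$ $\log$ is the natural logarithm. *)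

(* Defs.v *)
From mathcomp Require Import all_boot all_order all_algebra.
From mathcomp Require Import all_classical all_reals all_analysis.

Set Implicit Arguments.
Unset Strict Implicit.
Unset Printing Implicit Defensive.

Import Order.TTheory GRing.Theory Num.Theory.

Local Open Scope classical_set_scope.
Local Open Scope ring_scope.

(* Parameters (p_s, r_s) of one state s: x.1 a s' is p(s' | s, a) and x.2 a is
   r(s, a). The alias R^o makes this space an lmodType over R, so that
   convex_set applies to it. *)
Definition state_param (R : realType) (S A : finType) : Type :=
  ({ffun A -> {ffun S -> R^o}} * {ffun A -> R^o})%type.

Definition transition_probabilities (R : realType) (S A : finType)
    (p : {ffun A -> {ffun S -> R^o}}) : Prop :=
  forall a : A, (forall s : S, 0 <= p a s) /\ \sum_(s : S) p a s = 1.

(* Measurability with respect to the Borel sigma-algebra of the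
   finite-dimensional space state_param R S A, i.e. of every coordinate. *)
Definition measurable_param (R : realType) (S A : finType)
    (d : measure_display) (T : measurableType d)
    (X : T -> state_param R S A) : Prop :=
  (forall (a : A) (s : S), measurable_fun setT (fun w => (X w).1 a s : R)) /\
  (forall a : A, measurable_fun setT (fun w => (X w).2 a : R)).

Definition uncertainty_product (R : realType) (S A : finType)
    (U : S -> set (state_param R S A)) : set (S -> state_param R S A) :=
  [set x | forall s : S, U s (x s)].

Definition uncertainty_budget (R : realType) (S A : finType)
    (U : S -> set (state_param R S A)) (x0 : S -> state_param R S A) (D : R) :
    set (S -> state_param R S A) :=
  [set x | uncertainty_product U x /\
           \sum_(s : S) (x s != x0 s)%:R <= D].

Definition mutually_independent (R : realType) (d : measure_display)
    (T : measurableType d) (P : probability T R) (I : finType)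
    (E : I -> set T) : Prop :=
  (forall i : I, measurable (E i)) /\
  forall J : {set I},
    P (\bigcap_(i in [set` J]) E i) = (\prod_(i in J) P (E i))%E.

(* Main.v *)
(* Bernstein's inequality for the number N of deviating states, by Chernoff's
   method: writing M for the sum of the alpha s, independence gives
   E[exp(l N)] = prod_s (1 + (exp l - 1) alpha_s) <= exp(M (exp l - 1)), hence
   P(N > M + t) <= exp(M (exp l - 1 - l) - l t). The elementary inequality
   (1 - l/3) (exp l - 1 - l) <= l^2/2 with l = t / (M + t/3) turns this into
   exp(- (t^2/2) / (M + t/3)), which equals delta for t = D' - M. *)
Require Import Defs.
From mathcomp Require Import all_boot all_order all_algebra.
From mathcomp Require Import all_classical all_reals all_analysis.
From mathcomp Require Import measurable_realfun ring lra.

Import Order.TTheory GRing.Theory Num.Theory.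
Import numFieldNormedType.Exports.

Local Open Scope classical_set_scope.
Local Open Scope ring_scope.

Lemma is_derive_ge0_le0 {R : realType} {f f' : R -> R} {x : R} :
  (forall y, is_derive y (1 : R) f (f' y)) -> (forall y, 0 <= y -> 0 <= f' y) ->
  0 <= x -> f 0 <= f x.
Proof.
move=> df f'_ge0 x_ge0.
have derf y : derivable f y 1 by exact: ex_derive.
apply: (@ger0_derive1_ndecry _ f 0) => // [y|].
  rewrite in_itv/= andbT derive1E derive_val => /ltW; exact: f'_ge0.
apply: continuous_subspaceT => y.
exact/differentiable_continuous/derivable1_diffP.
Qed.

(** The difference [f] of the two sides satisfies [f 0 = f' 0 = 0], and its second derivative is
    nonnegative because [1 - y <= expR (- y)]; integrating twice from 0 gives the claim. The factor
    [1 - l / 3] is not divided out, since [l = 3] does occur below, when [M = 0]. *)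
Lemma expR_bernstein {R : realType} {l : R} : 0 <= l ->
  (1 - l / 3) * (expR l - 1 - l) <= l ^+ 2 / 2.
Proof.
move=> l_ge0; rewrite -subr_ge0.
pose f (y : R) := y ^+ 2 / 2 - (1 - y / 3) * (expR y - 1 - y).
pose f' (y : R) := y + (expR y - 1 - y) / 3 - (1 - y / 3) * (expR y - 1).
pose f'' (y : R) := (1 - expR y * (1 - y)) / 3.
have df y : is_derive y (1 : R) f (f' y).
  by apply: is_derive_eq; rewrite /f' /GRing.scale/=; field.
have df' y : is_derive y (1 : R) f' (f'' y).
  by apply: is_derive_eq; rewrite /f'' /GRing.scale/=; field.
have f''_ge0 y : 0 <= f'' y.
  rewrite divr_ge0// subr_ge0 -ler_pdivlMl ?expR_gt0// mulr1 -expRN.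
  exact: expR_ge1Dx.
have f'_ge0 y : 0 <= y -> 0 <= f' y.
  move=> y_ge0; have -> : 0 = f' 0 by rewrite /f' expR0; field.
  exact: (is_derive_ge0_le0 df' (fun z _ => f''_ge0 z)).
have -> : 0 = f 0 by rewrite /f expR0; field.
exact: (is_derive_ge0_le0 df f'_ge0).
Qed.

Lemma bernstein_exponent {R : realType} {M L : R} : 0 <= M -> 0 < L ->
  exists2 l : R, 0 <= l &
    M * (expR l - 1) -
      l * (M + 1 / 3 * L * (1 + Num.sqrt (1 + 18 * (M / L)))) <= - L.
Proof.
move=> M_ge0 L_gt0; set t := 1 / 3 * L * _.
have rad_ge0 : 0 <= 1 + 18 * (M / L).
  by rewrite addr_ge0// mulr_ge0// divr_ge0// ltW.
have t_gt0 : 0 < t.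
  by rewrite mulr_gt0 ?mulr_gt0// ltr_pwDl// sqrtr_ge0.
(* t is the positive root of the quadratic equating Bernstein's exponent
   (t ^+ 2 / 2) / (M + t / 3) with L. *)
have tE : t ^+ 2 = 2 * L * (M + t / 3).
  have -> : t ^+ 2 = (1 / 9) * L ^+ 2 *
      (1 + 2 * Num.sqrt (1 + 18 * (M / L)) + Num.sqrt (1 + 18 * (M / L)) ^+ 2).
    by rewrite /t; field.
  rewrite sqr_sqrtr// /t; field; exact: lt0r_neq0.
pose b := M + t / 3.
have b_gt0 : 0 < b by rewrite ltr_wpDl// divr_gt0.
have l_ge0 : 0 <= t / b by rewrite divr_ge0// ltW.
(* This [l] minimises [l ^+ 2 / 2 * b - l * t], the bound obtained below for the exponent; the
   minimum is [- t ^+ 2 / (2 * b) = - L] by [tE]. *)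
exists (t / b) => //.
have key := expR_bernstein l_ge0.
set l := t / b in l_ge0 key *.
have lb : l * b = t by rewrite /l divfK// lt0r_neq0.
have {}key : M * (expR l - 1 - l) <= l ^+ 2 / 2 * b.
  (* As [l * b = t], the factor [1 - l / 3] is exactly [M / b]. *)
  have -> : M = (1 - l / 3) * b.
    by rewrite mulrBl mul1r mulrAC lb /b; ring.
  by rewrite mulrAC ler_pM2r.
have : l * t = 2 * L.
  by rewrite /l mulrAC -expr2 tE mulfK// lt0r_neq0.
have : l ^+ 2 / 2 * b = l * t / 2 by rewrite -lb; field.
nra.
Qed.

Section sum_of_independent_indicators.
Context {R : realType} {d : measure_display} {T : measurableType d}
  {P : probability T R} {I : finType} {E : I -> set T} {a : I -> R}
  (indepE : mutually_independent P E) (PE : forall i, P (E i) = (a i)%:E).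

Let EJ (J : {set I}) : set T := \bigcap_(i in [set` J]) E i.

Let measurable_EJ J : measurable (EJ J).
Proof. by apply: fin_bigcap_measurable => // i _; exact: indepE.1. Qed.

Let measurable_N : measurable_fun setT (fun w => \sum_i \1_(E i) w : R).
Proof.
by apply: measurable_sum => i; apply: measurable_indic; exact: indepE.1.
Qed.

Lemma measurable_sum_indic_gt (t : R) :
  measurable [set w | t < \sum_i \1_(E i) w].
Proof.
rewrite (_ : [set w | _] =
  setT `&` (fun w => \sum_i \1_(E i) w) @^-1` `]t, +oo[).
  exact: measurable_N.
by rewrite setTI; apply/seteqP; split => w /=; rewrite in_itv/= andbT.
Qed.

(* Expanding [\prod_i (1 + (expR l - 1) * \1_(E i) w)] leaves only
   intersections of the [E i], never of their complements, so that the product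
   rule for intersections directly gives the expectation. *)
Lemma expR_sum_indic (l : R) w :
  expR (l * \sum_i \1_(E i) w) =
  \sum_(J : {set I}) (expR l - 1) ^+ #|J| * \1_(EJ J) w.
Proof.
rewrite mulr_sumr expR_sum.
transitivity (\prod_i ((expR l - 1) * \1_(E i) w + 1)).
  apply: eq_bigr => i _; rewrite indicE.
  by case: (w \in E i); rewrite ?mulr1 ?mulr0 ?expR0 ?add0r ?subrK.
rewrite bigA_distr; apply: eq_bigr => J _.
rewrite -big_mkcond big_split/= prodr_const; congr (_ * _).
rewrite indicE; have [/set_mem wJ|/negP wJ] := boolP (w \in EJ J).
  by rewrite big1// => i iJ; rewrite indicE mem_set//; exact: wJ.
have [i iJ wi] : exists2 i, i \in J & w \notin E i.
  apply: contra_notP wJ => h; apply/mem_set => i /= iJ.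
  by apply: contrapT => wi; apply: h; exists i => //; rewrite notin_setE.
by rewrite (bigD1 i)//= indicE (negbTE wi) mul0r.
Qed.

Lemma mgf_sum_indic {l : R} : 0 <= l ->
  (\int[P]_w (expR (l * \sum_i \1_(E i) w))%:E)%E =
  (\prod_i (1 + (expR l - 1) * a i))%:E.
Proof.
move=> l_ge0; have c_ge0 : 0 <= expR l - 1.
  by rewrite subr_ge0 -expR0 ler_expR.
under eq_integral do rewrite expR_sum_indic -sumEFin.
rewrite ge0_integral_sum//; first last.
- by move=> J w _; rewrite lee_fin mulr_ge0// exprn_ge0.
- move=> J; apply/measurable_EFinP/measurable_funM => //.
transitivity (\sum_(J : {set I})
  ((expR l - 1) ^+ #|J| * \prod_(i in J) a i)%:E)%E.
  apply: eq_bigr => J _.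
  under eq_integral do rewrite EFinM.
  rewrite ge0_integralZl_EFin ?exprn_ge0//; last first.
    exact/measurable_EFinP.
  rewrite integral_indic// setIT EFinM; congr (_ * _)%E.
  by rewrite -prodEFin; apply: etrans (indepE.2 J) _; apply: eq_bigr.
(* The expansion over subsets is now folded back into a product, with [a i] in place of the
   indicator of [E i]. *)
rewrite sumEFin; congr EFin.
under [RHS]eq_bigr do rewrite addrC.
rewrite bigA_distr; apply: eq_bigr => J _.
by rewrite -big_mkcond big_split/= prodr_const.
Qed.

Lemma chernoff_sum_indic {l : R} (t : R) : 0 <= l ->
  (P [set w | (t < \sum_i \1_(E i) w)%R] <=
   (expR ((\sum_i a i) * (expR l - 1) - l * t))%:E)%E.
Proof.
move=> l_ge0.
have a_ge0 i : 0 <= a i by rewrite -lee_fin -PE.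
have c_ge0 : 0 <= expR l - 1 by rewrite subr_ge0 -expR0 ler_expR.
set A := [set w | _].
have mA : measurable A by exact: measurable_sum_indic_gt.
have -> : P A = (\int[P]_w (\1_A w)%:E)%E by rewrite integral_indic// setIT.
(* Markov's inequality for the exponential: the integrand on the right is nonnegative everywhere and
   at least 1 on [A]. *)
apply: (@le_trans _ _ (\int[P]_w ((expR (- (l * t)))%:E *
                      (expR (l * \sum_i \1_(E i) w))%:E))%E).
  have mexp : measurable_fun setT (fun w => (expR (l * \sum_i \1_(E i) w))%:E).
    apply/measurable_EFinP/measurableT_comp => //.
    exact: measurable_funM.
  apply: ge0_le_integral => //.
  - by apply/measurable_EFinP; exact: measurable_indic.
  - exact: measurable_funeM.
  move=> w _; rewrite -EFinM lee_fin -expRD indicE.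
  have [/set_mem Aw|_] := boolP (w \in A); last exact: expR_ge0.
  rewrite -[leLHS]expR0 ler_expR addrC subr_ge0.
  by rewrite ler_wpM2l// ltW.
rewrite ge0_integralZl_EFin ?expR_ge0//; last first.
  apply/measurable_EFinP/measurableT_comp => //.
  exact: measurable_funM.
rewrite mgf_sum_indic// -EFinM lee_fin.
rewrite (addrC (_ * _)) expRD ler_pM2l ?expR_gt0//.
(* Factor by factor, this is [1 + x <= expR x] with [x = a i * (expR l - 1)]. *)
rewrite mulr_suml expR_sum ler_prod// => i _.
by rewrite addr_ge0 ?mulr_ge0//= mulrC expR_ge1Dx.
Qed.

End sum_of_independent_indicators.

Theorem theorem1 (R : realType) (S A : finType)
    (x0 : S -> state_param R S A) (U : S -> set (state_param R S A))
    (U_prob : forall (s : S) (x : state_param R S A),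
      U s x -> transition_probabilities x.1)
    (U_convex : forall s : S, convex_set (U s))
    (U_nominal : forall s : S, U s (x0 s))
    (d : measure_display) (T : measurableType d) (P : probability T R)
    (X : T -> S -> state_param R S A)
    (X_meas : forall s : S, measurable_param (fun w : T => X w s))
    (X_in_U : forall w : T, uncertainty_product U (X w))
    (alpha : S -> R)
    (X_indep : mutually_independent P (fun s : S => [set w | X w s != x0 s]))
    (X_alpha : forall s : S, P [set w | X w s != x0 s] = (alpha s)%:E)
    (delta : R) (delta_gt0 : 0 < delta) (delta_lt1 : delta < 1) :
  let D' := \sum_(s : S) alpha s +
    1 / 3%:R * ln (1 / delta) *
      (1 + Num.sqrt (1 + 18%:R * ((\sum_(s : S) alpha s) / ln (1 / delta)))) in
  ((1 - delta)%:E <= P [set w | uncertainty_budget U x0 D' (X w)])%E.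
Proof.
cbv zeta; set D' := \sum_s alpha s + _.
pose E s := [set w | X w s != x0 s].
have alpha_ge0 s : 0 <= alpha s by rewrite -lee_fin -X_alpha.
have lnV : ln (1 / delta) = - ln delta by rewrite div1r lnV// posrE.
have L_gt0 : 0 < ln (1 / delta) by rewrite lnV oppr_gt0 ln_lt0// delta_gt0.
have M_ge0 : 0 <= \sum_s alpha s by exact: sumr_ge0.
have [l l_ge0 lP] := bernstein_exponent M_ge0 L_gt0.
have tail := chernoff_sum_indic X_indep X_alpha D' l_ge0.
(* Every [X w] lies in the product of the sets [U s], so the budget can fail only through the number
   of deviations. *)
have -> : [set w | uncertainty_budget U x0 D' (X w)] =
    ~` [set w | D' < \sum_s \1_(E s) w].
  have NE w : \sum_s \1_(E s) w = \sum_s (X w s != x0 s)%:R :> R.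
    apply: eq_bigr => s _; rewrite indicE.
    by congr (_%:R); congr nat_of_bool; apply/idP/idP => [/set_mem|/mem_set].
  apply/seteqP; split=> w /=; rewrite NE.
    by move=> [_]; rewrite leNgt => /negP.
  by move=> /negP; rewrite -leNgt; split.
rewrite probability_setC; last exact: measurable_sum_indic_gt X_indep _.
rewrite EFinB leeB// (le_trans tail)// lee_fin.
(* The exponent is at most [- ln (1 / delta) = ln delta], whose exponential is [delta]. *)
apply: (@le_trans _ _ (expR (- ln (1 / delta)))).
  by rewrite ler_expR.
by rewrite lnV opprK lnK// posrE.
Qed.
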